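(* Let $X$ be a normal Hausdorff cellular-Lindelöf space with a $G_\delta$-diagonal of rank $2$. Then $|X| \leq \mathfrak{c}$.
   Context: Here $\mathfrak{c}=2^{\aleph_0}$. A cellular family in a topological space $X$ is a family of pairwise disjoint non-empty open subsets of $X$. A space $X$ is called cellular-Lindelöf if for every cellular family $\mathcal{U}$ in $X$ there is a Lindelöf subspace $L$ of $X$ such that $U \cap L \neq \emptyset$ for every $U \in \mathcal{U}$. For a cover $\mathcal{U}$ of $X$ and $A \subset X$, $St(A,\mathcal{U})=\bigcup\{U\in\mathcal{U}: U\cap A\neq\emptyset\}$, and $St(x,\mathcal{U})=St(\{x\},\mathcal{U})$ for $x \in X$. A space $X$ has a $G_\delta$-diagonal of rank $2$ if there exists a sequence $\{\mathcal{U}_n: n<\omega\}$ of open covers of $X$ such that $\bigcap\{St(St(x,\mathcal{U}_n),\mathcal{U}_n): n<\omega\}=\{x\}$ for every $x\in X$. *)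

(* Defs.v *)
From mathcomp Require Import all_boot all_order all_algebra.
From mathcomp Require Import all_classical.
From mathcomp Require Import topology.

Set Implicit Arguments.
Unset Strict Implicit.
Unset Printing Implicit Defensive.

Local Open Scope classical_set_scope.

(* Families of subsets of X are elements of [set (set X)], indexed by
   themselves when a library notion expects an indexed family. *)

Definition cellular_family (X : topologicalType) (U : set (set X)) : Prop :=
  [/\ forall V, U V -> open V,
      forall V, U V -> V !=set0 &
      trivIset U id].

(* [open_fam_of L C id] says that the members of C are open in the subspace
   topology of L, so this is the Lindelof property of L as a subspace of X. *)
Definition lindelof (X : topologicalType) (L : set X) : Prop :=
  forall C : set (set X), open_fam_of L C id -> L `<=` \bigcup_(V in C) V ->
  exists C' : set (set X),
    [/\ C' `<=` C, countable C' & L `<=` \bigcup_(V in C') V].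

Definition cellular_lindelof (X : topologicalType) : Prop :=
  forall U : set (set X), cellular_family U ->
  exists L : set X, lindelof L /\ forall V, U V -> V `&` L !=set0.

Definition open_cover (X : topologicalType) (U : set (set X)) : Prop :=
  (forall V, U V -> open V) /\ \bigcup_(V in U) V = setT.

Definition star (T : Type) (A : set T) (U : set (set T)) : set T :=
  \bigcup_(V in [set V | U V /\ V `&` A !=set0]) V.

Definition Gdelta_diagonal_rank2 (X : topologicalType) : Prop :=
  exists U : nat -> set (set X),
    (forall n, open_cover (U n)) /\
    (forall x : X, \bigcap_n star (star [set x] (U n)) (U n) = [set x]).

(* Main.v *)
Require Import Defs.
From mathcomp Require Import all_boot all_order all_algebra.
From mathcomp Require Import all_classical.
From mathcomp Require Import topology.

Local Open Scope classical_set_scope.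
Local Open Scope card_scope.

(** Write [E n x y] when the [n]-th stars of [x] and [y] are disjoint; rank 2
    says that any two distinct points are [E n]-related for some [n].
    An [E n]-clique [S] is closed discrete, so normality shrinks its disjoint
    stars to a discrete open family, and a Lindelof set meeting every member
    of a discrete family forces the family, hence [S], to be countable.
    It remains to see that countable cliques bound the space by the continuum
    (the Erdos-Rado relation (2^omega)^+ -> (omega_1)^2_omega): let [M] have size
    at most the continuum and realize every [E]-type over a countable subset of
    [M] that is realized in the space. If [p] were outside [M], choose for each
    [n] a maximal [E n]-clique in [M] among the points [E n]-related to [p];
    a point of [M] with the same type as [p] over all of them is [E n]-related
    to [p] for some [n], and extends the [n]-th clique. *)

(* Well-founded terms: evaluating them closes a set under continuum many
   omega-ary operations at once, without a transfinite iteration. *)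
Inductive omega_tree : Type :=
| Leaf
| Node of (nat -> nat) & (nat -> omega_tree).

(* A tree is recovered from the labels found along finite branches. *)
Fixpoint omega_tree_code (t : omega_tree) (s : seq nat) (k : nat) : nat :=
  match t with
  | Leaf => 0
  | Node h g => if s is i :: s' then omega_tree_code (g i) s' k else (h k).+1
  end.

Lemma omega_tree_code_inj : injective omega_tree_code.
Proof.
elim=> [|h g IH] [|h' g'] // e.
- by have := congr1 (fun c => c [::] 0) e.
- by have := congr1 (fun c => c [::] 0) e.
congr Node.
  by apply/funext => k; have /= [] := congr1 (fun c => c [::] k) e.
apply/funext => i; apply: IH; apply/funext => s; apply/funext => k.
exact: (congr1 (fun c => c (i :: s) k) e).
Qed.

Lemma card_omega_tree : [set: omega_tree] #<= [set: set nat].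
Proof.
apply/pcard_injP.
exists (fun t => [set m | exists s k, m = pickle (s, k, omega_tree_code t s k)]).
move=> t t' _ _ e; apply: omega_tree_code_inj.
apply/funext => s; apply/funext => k.
have : [set m | exists s k, m = pickle (s, k, omega_tree_code t s k)]
         (pickle (s, k, omega_tree_code t s k)) by exists s, k.
by rewrite e => -[s' [k' /(pcan_inj pickleK) [-> -> ->]]].
Qed.

(** [M] consists of the values of all trees: a sequence in [M] lifts, by choice, to a sequence of
    trees, and a [Node] joins these into one. *)
Lemma omega_ary_closure (X : Type) (x0 : X)
    (F : (nat -> nat) -> (nat -> X) -> X) :
  exists M : set X, [/\ M x0,
    forall h u, (forall k, M (u k)) -> M (F h u) & M #<= [set: set nat]].
Proof.
pose ev := fix ev t := if t is Node h g then F h (fun k => ev (g k)) else x0.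
exists (range ev); split; first by exists Leaf.
- move=> h u uM.
  have /choice [g gu] : forall k, exists t, ev t = u k.
    by move=> k; have [t _ <-] := uM k; exists t.
  exists (Node h g) => //=; congr F; exact/funext.
- exact: card_le_trans (card_image_le _ _) card_omega_tree.
Qed.

Lemma maximal_clique (X : Type) (R : X -> X -> Prop) (D : set X) :
  exists A : set X,
    [/\ A `<=` D, forall x y, A x -> A y -> x <> y -> R x y &
        forall x, D x -> (forall a, A a -> R x a /\ R a x) -> A x].
Proof.
pose P := [set A : set X |
  A `<=` D /\ forall x y, A x -> A y -> x <> y -> R x y].
have [|A [[AD AR] Amax]] := @Zorn_bigcup X P.
  move=> C CP tot; split=> [x [B CB Bx]|x y [B CB Bx] [B' CB' B'y] xy].
    by have [+ _] := CP _ CB; apply.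
  have [BB'|B'B] := tot _ _ CB CB'.
    by have [_] := CP _ CB'; apply=> //; exact: BB'.
  by have [_] := CP _ CB; apply=> //; exact: B'B.
exists A; split=> // x Dx xA; apply: contrapT => nAx.
apply: (Amax (x |` A)).
  split; first by move=> ? ?; right.
  by move=> /(_ x) xAA; apply: nAx; apply: xAA; left.
split=> [y [->|/AD]//|y z [->|Ay] [->|Az] yz] //.
- by have [] := xA _ Az.
- by have [] := xA _ Ay.
- exact: AR.
Qed.

(** [b0] is the value at indices that the injection misses, so an empty [B] is allowed. *)
Lemma countable_enum (T : Type) (B : set T) (b0 : T) : countable B ->
  exists u : nat -> T, B `<=` range u /\ range u `<=` b0 |` B.
Proof.
move=> /countable_injP [f finj].
have /choice [u uP] : forall k, exists b,
    (b = b0 \/ B b) /\ forall c, B c -> f c = k -> b = c.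
  move=> k; have [[b [Bb fb]]|nb] := pselect (exists b, B b /\ f b = k).
    exists b; split; first by right.
    by move=> c Bc fc; apply: finj; rewrite ?inE// fb fc.
  exists b0; split; first by left.
  by move=> c Bc fc; exfalso; apply: nb; exists c.
exists u; split=> [b Bb|_ [k _ <-]].
  by exists (f b) => //; have [_] := uP (f b); apply.
by have [[->|]] := uP k; [left|right].
Qed.

Lemma card_le_continuum_of_countable_cliques (X : Type)
    (E : nat -> X -> X -> Prop)
    (Esym : forall n x y, E n x y -> E n y x)
    (Eirr : forall n x, ~ E n x x)
    (Etot : forall x y, x <> y -> exists n, E n x y)
    (Ecount : forall n (S : set X),
      (forall x y, S x -> S y -> x <> y -> E n x y) -> countable S) :
  [set: X] #<= [set: set nat].
Proof.
have [[x0 _]|/set0P/negP] := pselect ([set: X] !=set0); last first.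
  by rewrite negbK => /eqP ->; exact: card_ge0.
(* [F] realizes the countable type coded by [hu] whenever some point does; otherwise its value is
   the dummy [x0]. *)
have /choice [F FP] : forall hu : (nat -> nat) * (nat -> X), exists x,
    forall p, (forall k, E (hu.1 k) p (hu.2 k)) ->
      forall k, E (hu.1 k) x (hu.2 k).
  move=> hu; have [[p pP]|np] :=
    pselect (exists p, forall k, E (hu.1 k) p (hu.2 k)); first by exists p.
  by exists x0 => p pP; exfalso; apply: np; exists p.
have [M [Mx0 MF cardM]] := omega_ary_closure X x0 (fun h u => F (h, u)).
suff -> : [set: X] = M by [].
apply/seteqP; split=> // p _; apply: contrapT => nMp.
have /choice [A AP] := fun n => maximal_clique X (E n) (M `&` E n p).
(* The pair [(n0, x0)] is the default of the enumeration below, so it has to satisfy the same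
   conditions as the clique points. *)
have [n0 pn0] : exists n, E n p x0.
  by apply: Etot => e; apply: nMp; rewrite e.
have cB : countable [set b : nat * X | A b.1 b.2].
  have : countable (\bigcup_(n in [set: nat]) (pair n @` A n)).
    apply: bigcup_countable => // n _.
    apply: sub_countable (card_image_le _ _) _.
    by apply: (Ecount n); have [] := AP n.
  apply: sub_countable; apply: subset_card_le => -[n a] /= Aa.
  by exists n => //; exists a.
have [u [Bu uB]] := @countable_enum _ _ (n0, x0) cB.
have uM k : M (u k).2 /\ E (u k).1 p (u k).2.
  have [|->//|] := uB (u k); first by exists k.
  by move=> Auk; have [/(_ _ Auk)] := AP (u k).1.
pose x := F (fst \o u, snd \o u).
have Mx : M x by apply: MF => k; have [] := uM k.
have xE k : E (u k).1 x (u k).2.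
  by apply: (FP (fst \o u, snd \o u) p) => j; have [] := uM j.
have [n pn] : exists n, E n p x by apply: Etot => e; apply: nMp; rewrite e.
have xA a : A n a -> E n x a.
  by move=> Aa; have [k _ uk] := Bu (n, a) Aa; have := xE k; rewrite uk.
(* [x] is [E n]-related to [p] and to all of [A n], so maximality puts [x] into [A n], and then
   [E n x x] follows. *)
have [_ _ /(_ x) Amax] := AP n.
apply: (Eirr n x); apply: (xA); apply: Amax => // a Aa.
by split; [|apply: Esym]; exact: xA.
Qed.

Definition discrete_family (X : topologicalType) (I : Type) (D : set I)
    (W : I -> set X) : Prop :=
  forall z : X, exists O : set X, [/\ open O, O z &
    forall i j, D i -> D j -> W i `&` O !=set0 -> W j `&` O !=set0 -> i = j].

(** The traces on [L] of open sets meeting at most one [W i] cover [L]. Sending [i] to a member of a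
    countable subcover that meets [W i] is injective. *)
Lemma lindelof_discrete_family_countable (X : topologicalType) (L : set X)
    (I : Type) (D : set I) (W : I -> set X) :
  lindelof L -> discrete_family X I D W -> (forall i, D i -> W i `&` L !=set0) ->
  countable D.
Proof.
move=> LL dW WL.
pose small (O : set X) := open O /\
  forall i j, D i -> D j -> W i `&` O !=set0 -> W j `&` O !=set0 -> i = j.
pose C := [set V | exists O, small O /\ V = L `&` O].
have [| |C' [C'C cC' LC']] := LL C.
- have /choice [g gP] : forall V, exists O, C V -> small O /\ V = L `&` O.
    move=> V; have [[O OV]|nV] := pselect (C V); first by exists O.
    by exists setT => /nV.
  by exists g => V CV; have [[]] := gP V CV.
- move=> z Lz; have [O [oO Oz Oi]] := dW z.
  by exists (L `&` O) => //; exists O.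
have /choice [V VP] : forall i, exists V, D i -> C' V /\ W i `&` V !=set0.
  move=> i; have [Di|nDi] := pselect (D i); last by exists set0.
  have [z [Wz Lz]] := WL i Di; have [V C'V Vz] := LC' z Lz.
  by exists V => _; split=> //; exists z.
have /countable_injP [f finj] := cC'.
apply/countable_injP; exists (f \o V) => i j; rewrite !inE => Di Dj /= e.
have [Ci [y [Wiy Vy]]] := VP i Di; have [Cj [z [Wjz Vz]]] := VP j Dj.
have VV : V i = V j by apply: finj; rewrite ?inE.
have [O [[_ OP] VO]] := C'C _ Ci.
apply: OP => //; [exists y|exists z]; split=> //.
  by move: Vy; rewrite VO => -[].
by move: Vz; rewrite -VV VO => -[].
Qed.

Section Stars.
Variables (X : topologicalType) (U : set (set X)).
Hypothesis coverU : open_cover U.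

Let st (x : X) := star [set x] U.

Lemma star1P (x z : X) : st x z <-> exists V, [/\ U V, V x & V z].
Proof.
split=> [[V [UV [y [Vy /= yx]]] Vz]|[V [UV Vx Vz]]].
  by exists V; split=> //; rewrite -yx.
by exists V => //; split=> //; exists x.
Qed.

Lemma star1_sym (x z : X) : st x z -> st z x.
Proof. by move=> /star1P [V [UV Vx Vz]]; apply/star1P; exists V. Qed.

Lemma star1_refl (x : X) : st x x.
Proof.
have : (\bigcup_(V in U) V) x by rewrite coverU.2.
by move=> [V UV Vx]; apply/star1P; exists V.
Qed.

Lemma open_star (A : set X) : open (star A U).
Proof. by apply: bigcup_open => V [UV _]; exact: coverU.1. Qed.

Lemma star_star1 (x y z : X) : st x z -> st y z -> star (st x) U y.
Proof.
move=> xz /star1P [V [UV Vy Vz]].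
by exists V => //; split=> //; exists z.
Qed.

(* Any point within a star of [S] sees only one of its points, so subsets of
   [S] are closed. *)
Lemma closed_disjoint_stars (S : set X) :
  hausdorff_space X ->
  (forall x y, S x -> S y -> x <> y -> st x `&` st y = set0) -> closed S.
Proof.
move=> hX disj z clz.
have [s [Ss zs]] := clz _ (open_nbhs_nbhs (conj (open_star _) (star1_refl z))).
have zs' := star1_sym _ _ zs.
have only s' : S s' -> st z s' -> s' = s.
  move=> Ss' zs''; apply: contrapT => /(disj _ _ Ss' Ss) /seteqP [+ _].
  by move=> /(_ z); apply; split; [exact: star1_sym zs''|exact: zs'].
suff -> : z = s by [].
apply: hX => B B' nB nB'.
have [s' [Ss' [zs'' Bs']]] :=
  clz _ (filterI (open_nbhs_nbhs (conj (open_star _) (star1_refl z))) nB).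
by exists s; split; [rewrite -(only s')|exact: nbhs_singleton].
Qed.

Lemma countable_disjoint_stars (S : set X) :
  normal_space X -> hausdorff_space X -> cellular_lindelof X ->
  (forall x y, S x -> S y -> x <> y -> st x `&` st y = set0) -> countable S.
Proof.
move=> nX hX cX disj.
have same x y z : S x -> S y -> st x z -> st y z -> x = y.
  move=> Sx Sy xz yz; apply: contrapT => /(disj _ _ Sx Sy) /seteqP [+ _].
  by move=> /(_ z); apply.
have [V0 SV0 clV0] : filter_from (set_nbhs S) closure (\bigcup_(x in S) st x).
  apply: nX (closed_disjoint_stars S hX disj) _ _.
  apply/set_nbhsP; exists (\bigcup_(x in S) st x); split=> //.
    by apply: bigcup_open => x _; exact: open_star.
  by move=> x Sx; exists x => //; exact: star1_refl.
have [V [oV SV VV0]] := (set_nbhsP _ _).1 SV0.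
pose W x := V `&` st x.
have [|L [LL WL]] := cX (W @` S).
  split.
  - by move=> _ [x _ <-]; apply: openI => //; exact: open_star.
  - by move=> _ [x Sx <-]; exists x; split; [exact: SV|exact: star1_refl].
  - move=> _ _ [x Sx <-] [y Sy <-] [z [[_ xz] [_ yz]]].
    by rewrite (same x y z).
apply: (lindelof_discrete_family_countable X L X S W) => //; last first.
  by move=> x Sx; apply: WL; exists x.
(* Discreteness of [W]: a point of [closure V0] lies in some star [st x], which meets no [W i] with
   [i] other than [x]; around any other point, the complement of [closure V0] misses [V] and so
   every [W i]. *)
move=> z; have [/clV0 [x Sx xz]|nz] := pselect (closure V0 z).
  exists (st x); split=> //; first exact: open_star.
  move=> i j Si Sj [y [[_ iy] xy]] [y' [[_ jy'] xy']].
  by rewrite (same i x y)// (same j x y').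
exists (~` closure V0); split=> //.
  by rewrite openC; exact: closed_closure.
move=> i j _ _ [y [[Vy _] ny]] _; exfalso; apply: ny.
exact/subset_closure/VV0.
Qed.

End Stars.

Theorem theorem13 (X : topologicalType)
    (normalX : normal_space X) (hausdorffX : hausdorff_space X)
    (cellularX : cellular_lindelof X) (diagX : Gdelta_diagonal_rank2 X) :
  [set: X] #<= [set: set nat].
Proof.
have [U [coverU diagU]] := diagX.
apply: (card_le_continuum_of_countable_cliques X
  (fun n x y => star [set x] (U n) `&` star [set y] (U n) = set0)).
- by move=> n x y; rewrite setIC.
- move=> n x /seteqP [+ _] => /(_ x); apply.
  by split; exact: star1_refl.
(* If the stars of [x] and [y] meet for every [n], then [y] lies in all double stars of [x], whose
   intersection is the point [x]. *)
- move=> x y xy; apply: contrapT => nE; apply: xy; symmetry.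
  have : (\bigcap_n star (star [set x] (U n)) (U n)) y; last by rewrite diagU.
  move=> n _; have [z [xz yz]] :
      star [set x] (U n) `&` star [set y] (U n) !=set0.
    by apply/set0P/eqP => e; apply: nE; exists n.
  exact: star_star1 xz yz.
- by move=> n S; exact: countable_disjoint_stars.
Qed.
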